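(* Let $1\le k\le n-1$. (i) The Stiefel manifold $St(k,n)$, understood as the coset space $U(n)/(U(1)^k\times U(n-k))$, has the matrix representation $$A(n,k)=B_n^0\cdot B_{n-1}^1\cdots B_{n-k+1}^{k-1},$$ obtained from the flag matrix $\mathfrak{M}_n=B_n^0B_{n-1}^1\cdots B_2^{n-2}$ by replacing the factor belonging to $U(n-k)$ by $I_{n-k}$; that is, every coset in $U(n)/(U(1)^k\times U(n-k))$ contains a matrix of the form $A(n,k)$ for some values of the parameters. Here $A(n,k)$ depends on $d_1=n^2-k-(n-k)^2=k(2n-k-1)$ real parameters. The corresponding projection is $$I_n-D_{T^*}=c_1c_1^*+\dots+c_kc_k^*,$$ where $c_1,\dots,c_k$ are the first $k$ column vectors of $A(n,k)$ and $D_{T^*}$ is the defect operator of the isometry with these columns. In this formula one may choose instead any $k$ of the $n$ column vectors of $A(n,k)$ (with $D_{T^*}$ the defect operator of the isometry formed by the chosen columns), a choice which can be made in $\binom{n}{k}$ ways. (ii) If the Stiefel manifold is instead understood as $U(n)/U(n-k)$, then its matrix representation is $$A(n,k)=B_n^0\cdot B_{n-1}^1\cdots B_{n-k+1}^{k-1},$$ where now the first phases of the generating vectors are not fixed but are also free parameters; that is, every coset in $U(n)/U(n-k)$ contains a matrix of this form. This form depends on $d_2=n^2-(n-k)^2=k(2n-k)$ real parameters.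
   Context: $^*$ is the conjugate transpose. $U(n-k)$ is embedded in $U(n)$ as the matrices $\begin{pmatrix} I_k&0\\0&M\end{pmatrix}$, $M\in U(n-k)$, and $U(1)^k\times U(n-k)$ as the block-diagonal matrices $\begin{pmatrix}\Delta&0\\0&M\end{pmatrix}$ with $\Delta$ diagonal unitary $k\times k$; for a subgroup $K$ the coset of $g$ in $U(n)/K$ is $gK$. For an isometry $\mathfrak{C}:\mathbb{C}^k\to\mathbb{C}^n$ ($\mathfrak{C}^*\mathfrak{C}=I_k$) the defect operator is $D_{T^*}=(I_n-\mathfrak{C}\mathfrak{C}^* )^{1/2}$. For $m\ge 1$, phases $\varphi_1,\dots,\varphi_m\in[0,2\pi)$ and angles $\theta_1,\dots,\theta_{m-1}\in[0,\pi/2]$ put $$y_m=(e^{i\varphi_1}\cos\theta_1,\ e^{i\varphi_2}\sin\theta_1\cos\theta_2,\ \dots,\ e^{i\varphi_{m-1}}\sin\theta_1\cdots\sin\theta_{m-2}\cos\theta_{m-1},\ e^{i\varphi_m}\sin\theta_1\cdots\sin\theta_{m-1})^t,$$ and let $B_m\in U(m)$ be the matrix generated by $y_m$, i.e. the matrix with columns $v_1=y_m$ and $v_{j+1}=\left.\frac{\partial v_1}{\partial\theta_j}\right|_{\theta_1=\dots=\theta_{j-1}=\pi/2}$, $j=1,\dots,m-1$ (first differentiate, then restrict). Put $B_{n-p}^p=\begin{pmatrix} I_p&0\\0&B_{n-p}\end{pmatrix}$. Each $B_m$ has its own independent angles and phases. In the flag matrix $\mathfrak{M}_n$ and in part (i),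 the first phase of each generating vector is fixed: $\varphi_1=0$ for $m=n$ and $\varphi_1=\pi$ for $m<n$, so that $B_m$ depends on $2(m-1)$ real parameters. In part (ii) all phases $\varphi_1,\dots,\varphi_m$ are free, so that $B_m$ depends on $2m-1$ real parameters. *)

(* Defs.v *)
From HB Require Import structures.
From mathcomp Require Import all_boot all_order all_algebra.
From mathcomp Require Import complex.
From mathcomp Require Import all_classical all_reals all_analysis.
Export numFieldNormedType.Exports.

Set Implicit Arguments.
Unset Strict Implicit.
Unset Printing Implicit Defensive.

Import Order.TTheory GRing.Theory Num.Theory.
Local Open Scope classical_set_scope.
Local Open Scope complex_scope.
Local Open Scope ring_scope.
Local Open Scope sesquilinear_scope.

Section Definitions.
Variable R : realType.

Definition cis (x : R) : R[i] := cos x +i* sin x.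

(* R[i] is not a normed R-module in the library, so functions R -> R[i] are
   differentiated componentwise. *)
Definition cderive (f : R -> R[i]) (x : R) : R[i] :=
  derive1 (fun t => complex.Re (f t)) x +i* derive1 (fun t => complex.Im (f t)) x.

Definition partial_derive m (f : ('I_m -> R) -> R[i]) (l : 'I_m)
    (theta : 'I_m -> R) : R[i] :=
  cderive (fun t => f [eta theta with l |-> t]) (theta l).

(* The vector y_{m+1}; indices start at 0. The last product is cos(theta_i),
   except in the last row i = m, where it is empty. *)
Definition gen_vector m (phi : 'I_m.+1 -> R) (theta : 'I_m -> R)
    : 'cV[R[i]]_m.+1 :=
  \col_i (cis (phi i)
          * (\prod_(l < m | (l < i)%N) sin (theta l))%:C
          * (\prod_(l < m | l == i :> nat) cos (theta l))%:C).

(* The matrix B_{m+1}. The restriction sets to pi/2 only angles other than the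
   one differentiated, so it is a partial derivative at the modified point. *)
Definition gen_matrix m (phi : 'I_m.+1 -> R) (theta : 'I_m -> R)
    : 'M[R[i]]_m.+1 :=
  row_mx (gen_vector phi theta)
    (\matrix_(i < m.+1, j < m)
      partial_derive (fun th => gen_vector phi th i 0) j
        (fun l => if (l < j)%N then pi / 2 else theta l)).

(* The block-diagonal matrix with blocks X and M, as an n x n matrix. It is
   only used when p + r = n; conform_mx then acts as a cast and its default
   value 1%:M plays no role. *)
Definition block_diag n p r (X : 'M[R[i]]_p) (M : 'M[R[i]]_r) : 'M[R[i]]_n :=
  conform_mx 1%:M (block_mx X 0 0 M).

Definition corner n p r (M : 'M[R[i]]_r) : 'M[R[i]]_n :=
  block_diag n (1%:M : 'M[R[i]]_p) M.

Definition U n : set 'M[R[i]]_n := [set g | g \is unitarymx].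

Definition corner_U n k : set 'M[R[i]]_n :=
  [set corner n k M | M in @U (n - k)].

Definition torus_corner_U n k : set 'M[R[i]]_n :=
  [set h | exists (Delta : 'M[R[i]]_k) (M : 'M[R[i]]_(n - k)),
     [/\ is_diag_mx Delta, U Delta, U M & h = block_diag n Delta M]].

Definition left_coset n (g : 'M[R[i]]_n) (K : set 'M[R[i]]_n) :
  set 'M[R[i]]_n := [set g *m h | h in K].

Definition coset_space n (K : set 'M[R[i]]_n) : set (set 'M[R[i]]_n) :=
  [set left_coset g K | g in @U n].

(* In the order on R[i], 0 <= z says that z is real and nonnegative. *)
Definition psd n (D : 'M[R[i]]_n) : Prop :=
  D^t* = D /\ forall v : 'cV[R[i]]_n, 0 <= (v^t* *m D *m v) 0 0.

Definition psd_sqrt n (P : 'M[R[i]]_n) : 'M[R[i]]_n :=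
  xget 0 [set D | psd D /\ D *m D = P].

Definition isometry_mx n r (C : 'M[R[i]]_(n, r)) : Prop :=
  C^t* *m C = 1%:M.

Definition defect n r (C : 'M[R[i]]_(n, r)) : 'M[R[i]]_n :=
  psd_sqrt (1%:M - C *m C^t*).

Definition orthogonal_projection n (P : 'M[R[i]]_n) : Prop :=
  P *m P = P /\ P^t* = P.

(* A function of the real parameters t i, i : I, with domain D: it has d
   parameters and changing any single one of them can change its value. *)
Definition depends_on_parameters (I : finType) (T : Type) (D : set (I -> R))
    (A : (I -> R) -> T) (d : nat) : Prop :=
  #|{: I}| = d /\
  forall i : I, exists t t' : I -> R,
    [/\ D t, D t', forall j, j != i -> t j = t' j & A t <> A t'].

(* The p-th factor (p < k) is B_{n-p}^p, with n - p - 1 angles (inl) and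
   either all of its n - p phases (free) or all but the first one (fixed). *)
Definition free_index n k :=
  {p : 'I_k & ('I_(n - p.+1) + 'I_(n - p.+1).+1)%type}.
Definition fixed_index n k :=
  {p : 'I_k & ('I_(n - p.+1) + 'I_(n - p.+1))%type}.

Section Free.
Variables (n k : nat) (t : free_index n k -> R).

Definition free_angle (p : 'I_k) (l : 'I_(n - p.+1)) : R :=
  t (Tagged (fun p : 'I_k => ('I_(n - p.+1) + 'I_(n - p.+1).+1)%type) (inl l)).
Definition free_phase (p : 'I_k) (l : 'I_(n - p.+1).+1) : R :=
  t (Tagged (fun p : 'I_k => ('I_(n - p.+1) + 'I_(n - p.+1).+1)%type) (inr l)).

Definition free_admissible : Prop :=
  forall p : 'I_k,
    (forall l, 0 <= free_angle (p := p) l <= pi / 2) /\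
    (forall l, 0 <= free_phase (p := p) l < 2 * pi).

Definition free_stiefel : 'M[R[i]]_n :=
  \big[mulmx/1%:M]_(p < k)
    corner n p (gen_matrix (free_phase (p := p)) (free_angle (p := p))).

End Free.

Section Fixed.
Variables (n k : nat) (t : fixed_index n k -> R).

Definition fixed_angle (p : 'I_k) (l : 'I_(n - p.+1)) : R :=
  t (Tagged (fun p : 'I_k => ('I_(n - p.+1) + 'I_(n - p.+1))%type) (inl l)).
Definition other_phase (p : 'I_k) (l : 'I_(n - p.+1)) : R :=
  t (Tagged (fun p : 'I_k => ('I_(n - p.+1) + 'I_(n - p.+1))%type) (inr l)).

Definition fixed_phase (p : 'I_k) (j : 'I_(n - p.+1).+1) : R :=
  if unlift ord0 j is Some l then other_phase (p := p) l
  else if val p == 0%N then 0 else pi.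

Definition fixed_admissible : Prop :=
  forall p : 'I_k,
    (forall l, 0 <= fixed_angle (p := p) l <= pi / 2) /\
    (forall l, 0 <= other_phase (p := p) l < 2 * pi).

Definition fixed_factor (p : 'I_k) : 'M[R[i]]_((n - p.+1).+1) :=
  gen_matrix (fixed_phase (p := p)) (fixed_angle (p := p)).

Definition fixed_stiefel : 'M[R[i]]_n :=
  \big[mulmx/1%:M]_(p < k) corner n p (fixed_factor p).

End Fixed.

Section Flag.
Variables (n k : nat) (lekn : (k <= n.-1)%N) (s : fixed_index n n.-1 -> R).

Definition flag_matrix : 'M[R[i]]_n :=
  \big[mulmx/1%:M]_(p < n.-1) corner n p (fixed_factor s p).

(* The product of the factors of the flag matrix with p >= k, read as a matrix
   of size n - k: the factor of the flag matrix belonging to U(n-k). *)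
Definition flag_tail : 'M[R[i]]_(n - k) :=
  \big[mulmx/1%:M]_(p < n.-1 | (k <= p)%N)
    corner (n - k)%N (p - k)%N (fixed_factor s p).

Definition flag_with (X : 'M[R[i]]_(n - k)) : 'M[R[i]]_n :=
  (\big[mulmx/1%:M]_(p < n.-1 | (p < k)%N) corner n p (fixed_factor s p))
  *m corner n k X.

Definition flag_restrict (x : fixed_index n k) : R :=
  s (Tagged (fun p : 'I_n.-1 => ('I_(n - p.+1) + 'I_(n - p.+1))%type)
       (tagged x : 'I_(n - (widen_ord lekn (tag x)).+1) + 'I_(n - (widen_ord lekn (tag x)).+1))).

End Flag.

End Definitions.

Arguments U {R n} _.
Arguments corner_U {R} n k _.
Arguments torus_corner_U {R} n k _.

(* Main.v *)
Require Import Defs.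
From HB Require Import structures.
From mathcomp Require Import all_boot all_order all_algebra.
From mathcomp Require Import complex.
From mathcomp Require Import all_classical all_reals all_analysis.
From mathcomp Require Import zify.

(* Up to the phases, B_m is a real orthogonal matrix: the derivatives of the
   spherical coordinates satisfy a recursion that adds one plane rotation per
   angle. Every unit vector is a generating vector, and after multiplication by
   a unit scalar it is one with a prescribed first phase. So for g in U(n) one
   can choose B_n with first column equal to that of g, up to a scalar u of
   modulus 1 in the case of fixed phases. Then B_n^* g is block diagonal with
   blocks u and g' in U(n-1); repeating this k times leaves an element of the
   subgroup on the right. The factors being invertible, the product depends on
   every parameter of every factor. Finally, C C^* is a projection for an
   isometry C, and a projection is its own positive square root, so that
   I - D = C C^*. *)

Set Implicit Arguments.
Unset Strict Implicit.
Unset Printing Implicit Defensive.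

Import Order.TTheory GRing.Theory Num.Theory.
Local Open Scope classical_set_scope.
Local Open Scope ring_scope.
Local Open Scope sesquilinear_scope.

(** * Polar coordinates *)

Section Angles.
Variable R : realType.
Local Open Scope complex_scope.

Lemma normc_cis (x : R) : `|cis x| = 1.
Proof. by rewrite normc_def /= cos2Dsin2 sqrtr1. Qed.

(** The cosine fixes the phase up to sign, so [acos a] serves when the imaginary part is nonnegative
    and [2 * pi - acos a] otherwise. *)
Lemma cis_surj (z : R[i]) :
  `|z| = 1 -> exists2 x : R, 0 <= x < 2 * pi & cis x = z.
Proof.
case: z => a b; rewrite normc_def /= => -[nab].
have sq1 : a ^+ 2 + b ^+ 2 = 1.
  by rewrite -(sqr_sqrtr (addr_ge0 (sqr_ge0 a) (sqr_ge0 b))) nab expr1n.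
have a1 : -1 <= a <= 1.
  by rewrite -ler_norml -sqrtr_sqr -(sqrtr1 R) ler_sqrt // -sq1 lerDl sqr_ge0.
have [/andP[acos0 acospi] acosE] := acos_def a1.
have sinE : sin (acos a) = `|b|.
  by rewrite sin_acos // -sq1 addrAC subrr add0r sqrtr_sqr.
have pi_gt0 := pi_gt0 R.
case: (leP 0 b) => b0.
  exists (acos a); last by rewrite /cis acosE sinE ger0_norm.
  by rewrite acos0 /= (le_lt_trans acospi) // mulr_natl mulr2n ltrDl.
(* This makes [2 * pi - acos a] strictly smaller than [2 * pi]. *)
have acos_neq0 : acos a != 0.
  apply: contraTneq b0 => e; move: sinE.
  by rewrite e sin0 => /esym/normr0_eq0 ->; rewrite ltxx.
exists (2 * pi - acos a).
  rewrite subr_ge0 (le_trans acospi) /=; last first.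
    by rewrite mulr_natl mulr2n lerDl ltW.
  by rewrite ltrBlDr ltrDl lt_def acos_neq0.
rewrite /cis mulr_natl cosB sinB cos2pi sin2pi !mul0r !mul1r addr0 sub0r.
by rewrite acosE sinE ltr0_norm // opprK.
Qed.

Lemma cis_normc (z : R[i]) :
  exists2 x : R, 0 <= x < 2 * pi & z = cis x * `|z|.
Proof.
have [->|z0] := eqVneq z 0.
  by exists 0; rewrite ?lexx ?mulr_gt0 ?pi_gt0 // normr0 mulr0.
have [|x xr xz] := @cis_surj (z / `|z|).
  by rewrite normf_div normr_id divff // normr_eq0.
by exists x => //; rewrite xz divfK // normr_eq0.
Qed.

Lemma cderive_scale (c : R[i]) (f : R -> R) (x : R) : derivable f x 1 ->
  cderive (fun t => c * (f t)%:C) x = c * (derive1 f x)%:C.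
Proof.
move=> df; case: c => a b; rewrite /cderive.
have -> : (fun t => complex.Re ((a +i* b) * (f t)%:C)) = (fun t => a * f t).
  by apply/funext => t /=; rewrite mulr0 subr0.
have -> : (fun t => complex.Im ((a +i* b) * (f t)%:C)) = (fun t => b * f t).
  by apply/funext => t /=; rewrite mulr0 add0r.
rewrite !derive1Ml //; apply/eqP; rewrite eq_complex /=.
by rewrite !mulr0 subr0 add0r !eqxx.
Qed.

Lemma polar_ge0 (a b : R) : 0 <= a -> 0 <= b ->
  exists2 x : R, 0 <= x <= pi / 2 &
    a = Num.sqrt (a ^+ 2 + b ^+ 2) * cos x /\
    b = Num.sqrt (a ^+ 2 + b ^+ 2) * sin x.
Proof.
move=> a0 b0; set r := Num.sqrt _.
have r0 : 0 <= r by exact: sqrtr_ge0.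
have rE : r ^+ 2 = a ^+ 2 + b ^+ 2 by rewrite sqr_sqrtr // addr_ge0 ?sqr_ge0.
have pi2 : 0 <= pi / 2 :> R by rewrite divr_ge0 // pi_ge0.
(* At the origin every angle works and 0 is taken; elsewhere the angle is the arccosine of
   [a / r]. *)
have [r_eq0|r_neq0] := eqVneq r 0.
  move/eqP: rE; rewrite r_eq0 expr0n eq_sym paddr_eq0 ?sqr_ge0 // !sqrf_eq0.
  by case/andP => /eqP-> /eqP->; exists 0; rewrite ?lexx // !mul0r.
have r_gt0 : 0 < r by rewrite lt_def r_neq0.
have ar : 0 <= a / r by rewrite divr_ge0.
have ar1 : a / r <= 1.
  by rewrite ler_pdivrMr // mul1r -(ger0_norm a0) -sqrtr_sqr ler_wsqrtr //
    lerDl sqr_ge0.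
have arN1 : -1 <= a / r <= 1 by rewrite ar1 (le_trans _ ar).
have [/andP[x0 xpi] xE] := acos_def arN1.
exists (acos (a / r)).
  (* Beyond [pi / 2] the cosine would be negative, but it equals [a / r]. *)
  rewrite x0 /= leNgt; apply/negP => xgt.
  have : cos (acos (a / r)) < cos (pi / 2).
    rewrite ltr_cos // in_itv /= ?x0 // pi2 /=.
    by rewrite ler_pdivrMr // mulr_natr mulr2n lerDl pi_ge0.
  by rewrite cos_pihalf xE ltNge ar.
split; first by rewrite xE mulrC divfK.
have bE : b ^+ 2 = (r * sin (acos (a / r))) ^+ 2.
  rewrite exprMn sin2cos2 xE expr_div_n mulrBr mulr1 mulrC divfK ?sqrf_eq0 //.
  by rewrite rE addrAC subrr add0r.
apply/eqP; rewrite -(eqrXn2 (n := 2)) ?bE //.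
by rewrite mulr_ge0 // sin_ge0_pi // x0.
Qed.

End Angles.

(** * Spherical coordinates and generated matrices *)

Section SphericalCoordinates.
Variable R : realType.
Local Open Scope complex_scope.

Definition spherical m (theta : 'I_m -> R) (i : 'I_m.+1) : R :=
  (\prod_(l < m | (l < i)%N) sin (theta l)) *
  (\prod_(l < m | l == i :> nat) cos (theta l)).

Lemma spherical0 m (theta : 'I_m.+1 -> R) :
  spherical theta ord0 = cos (theta ord0).
Proof.
by rewrite /spherical big_pred0 // mul1r (big_pred1 ord0).
Qed.

(** Only the first row lacks the factor [sin (theta ord0)]; what remains in the others is the same
    formula for the later angles. All inductions on the number of angles rest on this. *)
Lemma sphericalS m (theta : 'I_m.+1 -> R) (i : 'I_m.+1) :
  spherical theta (lift ord0 i) =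
  sin (theta ord0) * spherical (fun l => theta (lift ord0 l)) i.
Proof.
rewrite /spherical mulrA; congr (_ * _).
  rewrite big_mkcond big_ord_recl /= [in RHS]big_mkcond; congr (_ * _).
rewrite big_mkcond big_ord_recl /= mul1r [RHS]big_mkcond.
by apply: eq_bigr => l _.
Qed.

Lemma gen_vectorE m (phi : 'I_m.+1 -> R) theta i :
  gen_vector phi theta i 0 = cis (phi i) * (spherical theta i)%:C.
Proof. by rewrite mxE -mulrA -rmorphM. Qed.

Lemma with_lift0 m (theta : 'I_m.+1 -> R) t :
  (fun l => [eta theta with ord0 |-> t] (lift ord0 l)) =
  (fun l => theta (lift ord0 l)).
Proof. exact/funext. Qed.

Lemma with_liftS m (theta : 'I_m.+1 -> R) j t :
  (fun l => [eta theta with lift ord0 j |-> t] (lift ord0 l)) =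
  [eta (fun l => theta (lift ord0 l)) with j |-> t].
Proof. by apply/funext => l /=; rewrite (inj_eq lift_inj). Qed.

Lemma with_at m (theta : 'I_m -> R) j t : [eta theta with j |-> t] j = t.
Proof. by rewrite /= eqxx. Qed.

Lemma with_lift_at0 m (theta : 'I_m.+1 -> R) j t :
  [eta theta with lift ord0 j |-> t] ord0 = theta ord0.
Proof. by []. Qed.

Lemma derivable_spherical m (theta : 'I_m -> R) (j : 'I_m) i x :
  derivable (fun t => spherical [eta theta with j |-> t] i) x 1.
Proof.
elim: m theta j i => [|m IHm] theta j i; first by case: j.
case: (unliftP ord0 i) => [i'|] ->; last first.
  case: (unliftP ord0 j) => [j'|] ->.
    under eq_fun do rewrite spherical0 with_lift_at0.
    exact: derivable_cst.
  under eq_fun do rewrite spherical0 with_at.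
  exact: derivable_cos.
case: (unliftP ord0 j) => [j'|] ->.
  under eq_fun do rewrite sphericalS with_liftS with_lift_at0.
  by apply: derivableM; [exact: derivable_cst|exact: IHm].
under eq_fun do rewrite sphericalS with_lift0 with_at.
by apply: derivableM; [exact: derivable_sin|exact: derivable_cst].
Qed.

Definition pihalf_below m (theta : 'I_m -> R) (j : 'I_m) (l : 'I_m) : R :=
  if (l < j)%N then pi / 2 else theta l.

(** The derivative is taken at [theta j] itself, since [pihalf_below] changes only the angles before
    [j]. *)
Definition spherical_derive m (theta : 'I_m -> R) (j : 'I_m) i : R :=
  derive1 (fun t => spherical [eta pihalf_below theta j with j |-> t] i)
    (theta j).

Lemma spherical_derive00 m (theta : 'I_m.+1 -> R) :
  spherical_derive theta ord0 ord0 = - sin (theta ord0).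
Proof.
rewrite /spherical_derive.
under eq_fun do rewrite spherical0 /=.
by rewrite derive1E derive_val.
Qed.

Lemma spherical_derive0S m (theta : 'I_m.+1 -> R) i :
  spherical_derive theta ord0 (lift ord0 i) =
  cos (theta ord0) * spherical (fun l => theta (lift ord0 l)) i.
Proof.
rewrite /spherical_derive.
under eq_fun do rewrite sphericalS with_lift0 /=.
by rewrite derive1Mr // derive1E derive_val.
Qed.

Lemma spherical_deriveS0 m (theta : 'I_m.+1 -> R) j :
  spherical_derive theta (lift ord0 j) ord0 = 0.
Proof.
rewrite /spherical_derive.
under eq_fun do rewrite spherical0 /=.
exact: derive1_cst.
Qed.

(** Restricting the first angle to [pi / 2] turns the factor [sin (theta ord0)] into 1. This is why
    the later columns are exactly those of the matrix for the remaining angles. *)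
Lemma spherical_deriveSS m (theta : 'I_m.+1 -> R) j i :
  spherical_derive theta (lift ord0 j) (lift ord0 i) =
  spherical_derive (fun l => theta (lift ord0 l)) j i.
Proof.
rewrite /spherical_derive; congr (derive1 _ _); apply/funext => t.
rewrite sphericalS with_liftS /= {1}/pihalf_below /= sin_pihalf mul1r.
congr (spherical [eta _ with j |-> t] i).
Qed.

Definition real_gen m (theta : 'I_m -> R) : 'M[R]_m.+1 :=
  \matrix_(i, j) if unlift ord0 j is Some l then spherical_derive theta l i
                 else spherical theta i.

Lemma row_mx_ord0 (T : Type) m n (A : 'cV[T]_m) (B : 'M[T]_(m, n)) i :
  row_mx A B i (ord0 : 'I_n.+1) = A i 0.
Proof. by rewrite mxE; case: split_ordP => // l _; rewrite ord1. Qed.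

Lemma row_mx_lift (T : Type) m n (A : 'cV[T]_m) (B : 'M[T]_(m, n)) i l :
  row_mx A B i (lift ord0 l : 'I_n.+1) = B i l.
Proof.
rewrite mxE; case: split_ordP => l' /(congr1 val) /=; first by rewrite ord1.
by rewrite /bump => -[/val_inj->].
Qed.

(** The phase of row [i] does not depend on the angles, so it passes through the derivative as a
    constant. *)
Lemma gen_matrixE m (phi : 'I_m.+1 -> R) theta i j :
  gen_matrix phi theta i j = cis (phi i) * (real_gen theta i j)%:C.
Proof.
rewrite [real_gen _ _ _]mxE.
case: (unliftP ord0 j) => [l|] ->; last by rewrite row_mx_ord0 gen_vectorE.
rewrite row_mx_lift mxE /partial_derive.
under eq_fun do rewrite gen_vectorE.
by rewrite cderive_scale ?ltnn //; apply: derivable_spherical.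
Qed.

Section Recursion.
Variables (m : nat) (theta : 'I_m.+1 -> R).
Let tail := fun l => theta (lift ord0 l).

Lemma real_gen00 : real_gen theta ord0 ord0 = cos (theta ord0).
Proof. by rewrite mxE unlift_none spherical0. Qed.

Lemma real_gen01 : real_gen theta ord0 (lift ord0 ord0) = - sin (theta ord0).
Proof. by rewrite mxE liftK spherical_derive00. Qed.

Lemma real_gen0S j : real_gen theta ord0 (lift ord0 (lift ord0 j)) = 0.
Proof. by rewrite mxE liftK spherical_deriveS0. Qed.

Lemma real_genS0 i :
  real_gen theta (lift ord0 i) ord0 = sin (theta ord0) * real_gen tail i ord0.
Proof. by rewrite !mxE !unlift_none sphericalS. Qed.

Lemma real_genS1 i :
  real_gen theta (lift ord0 i) (lift ord0 ord0) =
  cos (theta ord0) * real_gen tail i ord0.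
Proof. by rewrite !mxE liftK unlift_none spherical_derive0S. Qed.

Lemma real_genSS i j :
  real_gen theta (lift ord0 i) (lift ord0 (lift ord0 j)) =
  real_gen tail i (lift ord0 j).
Proof. by rewrite !mxE !liftK spherical_deriveSS. Qed.

End Recursion.

End SphericalCoordinates.

Section GeneratedMatrix.
Variable R : realType.

(* Up to a rotation of the first two columns, [real_gen theta] is the block sum
   of 1 and the same matrix for the remaining angles. *)
Lemma real_gen_orthogonal m (theta : 'I_m -> R) :
  (real_gen theta)^T *m real_gen theta = 1%:M.
Proof.
suff col_dot i j : \sum_k real_gen theta k i * real_gen theta k j = (i == j)%:R.
  apply/matrixP => i j; rewrite mxE [RHS]mxE -[RHS]col_dot.
  by apply: eq_bigr => k _; rewrite mxE.
elim: m theta i j => [|m IHm] theta i j.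
  rewrite big_ord1 !ord1 !mxE unlift_none /spherical !big_pred0; try by case.
  by rewrite !mulr1.
have s2c2 := cos2Dsin2 (theta ord0).
have liftE (a b : 'I_m.+1) : (lift ord0 a == lift ord0 b) = (a == b).
  exact: (inj_eq lift_inj).
have sumE a b := IHm (fun l => theta (lift ord0 l)) a b.
(* The inner product of real columns is symmetric. The entries have different formulas in column 0,
   in column 1 and in the later columns, which gives the six cases below. *)
wlog le_ij : i j / (j <= i)%N.
  move=> H; case: (leqP j i) => [/H //|/ltnW/H ij]; rewrite eq_sym -ij.
  by apply: eq_bigr => k _; rewrite mulrC.
rewrite big_ord_recl.
case: (unliftP ord0 j) le_ij => [j1|] -> => [|_].
  case: (unliftP ord0 i) => [i1|] -> // le_ij1; rewrite liftE.
  case: (unliftP ord0 j1) le_ij1 => [j2|] -> => [|_].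
    case: (unliftP ord0 i1) => [i2|] -> // _.
    under eq_bigr do rewrite !real_genSS.
    by rewrite sumE !real_gen0S mul0r add0r.
  case: (unliftP ord0 i1) => [i2|] ->.
    under eq_bigr do rewrite real_genSS real_genS1 mulrCA.
    by rewrite -big_distrr /= sumE !real_gen0S mul0r add0r mulr0.
  under eq_bigr do rewrite real_genS1 mulrACA.
  by rewrite -big_distrr /= sumE real_gen01 mulrNN mulr1 -!expr2 addrC.
case: (unliftP ord0 i) => [i1|] ->.
  case: (unliftP ord0 i1) => [i2|] ->.
    under eq_bigr do rewrite real_genSS real_genS0 mulrCA.
    by rewrite -big_distrr /= sumE !real_gen0S mul0r add0r mulr0.
  under eq_bigr do rewrite real_genS1 real_genS0 mulrACA.
  rewrite -big_distrr /= sumE real_gen01 real_gen00 mulr1 mulNr.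
  by rewrite [sin _ * _]mulrC addNr.
under eq_bigr do rewrite real_genS0 mulrACA.
by rewrite -big_distrr /= sumE real_gen00 mulr1 -!expr2.
Qed.

Local Open Scope complex_scope.

Lemma gen_matrix_unitary m (phi : 'I_m.+1 -> R) theta :
  gen_matrix phi theta \is unitarymx.
Proof.
have -> : gen_matrix phi theta = diag_mx (\row_i cis (phi i)) *m
    map_mx (real_complex R) (real_gen theta).
  by apply/matrixP => i j; rewrite mul_diag_mx gen_matrixE !mxE.
apply: mul_unitarymx; apply/unitarymxP.
  apply/matrixP => i j; rewrite mul_diag_mx !mxE.
  have [<-|] := eqVneq j i; last first.
    by rewrite !mulr0n conjC0 mulr0.
  by rewrite mulr1n -normCK normc_cis expr1n.
have -> : (map_mx (real_complex R) (real_gen theta))^t* =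
    map_mx (real_complex R) (real_gen theta)^T.
  by apply/matrixP => i j; rewrite !mxE; apply: conjc_real.
by rewrite -map_mxM (mulmx1C (real_gen_orthogonal theta)) map_mx1.
Qed.

Definition phase_ok (x : R) := 0 <= x < 2 * pi.
Definition angle_ok (x : R) := 0 <= x <= pi / 2.

(** By induction the later coordinates are spherical with norm [s]; the polar angle of the point
    [(r ord0, s)] becomes the first angle. Keeping the norm as a factor avoids a division when [s]
    is 0. *)
Lemma spherical_surj m (r : 'I_m.+1 -> R) : (forall i, 0 <= r i) ->
  exists2 theta : 'I_m -> R, forall l, angle_ok (theta l) &
    forall i, r i = Num.sqrt (\sum_l r l ^+ 2) * spherical theta i.
Proof.
elim: m r => [|m IHm] r r0.
  exists (fun=> 0); first by case.
  move=> i; rewrite ord1 big_ord1 sqrtr_sqr ger0_norm // /spherical.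
  by rewrite !big_pred0 ?mulr1 //; case.
have [theta theta_ok thetaE] := IHm (fun i => r (lift ord0 i)) (fun=> r0 _).
set s := Num.sqrt _ in thetaE.
have sE : s ^+ 2 = \sum_i r (lift ord0 i) ^+ 2.
  by rewrite sqr_sqrtr // sumr_ge0 // => i _; rewrite sqr_ge0.
have [x x_ok [rE sinE]] := polar_ge0 (r0 ord0) (sqrtr_ge0 _ : 0 <= s).
rewrite big_ord_recl -sE.
exists (fun l => if unlift ord0 l is Some l' then theta l' else x).
  by move=> l; case: unliftP => [l'|] _ //; apply: theta_ok.
move=> i; case: (unliftP ord0 i) => [i'|] ->.
  rewrite sphericalS unlift_none mulrA -sinE thetaE; congr (_ * spherical _ _).
  by apply/funext => l; rewrite liftK.
by rewrite spherical0 unlift_none.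
Qed.

(** The arguments of the entries give the phases, and their moduli, a real unit vector, give the
    angles. *)
Lemma gen_vector_surj m (c : 'cV[R[i]]_m.+1) : \sum_i `|c i 0| ^+ 2 = 1 ->
  exists (phi : 'I_m.+1 -> R) (theta : 'I_m -> R),
    [/\ forall i, phase_ok (phi i), forall l, angle_ok (theta l) &
        c = gen_vector phi theta].
Proof.
move=> c1.
have /choice[phi phiP] : forall i, exists x,
    phase_ok x /\ c i 0 = cis x * `|c i 0|.
  by move=> i; have [x ? ?] := cis_normc (c i 0); exists x.
pose r i := complex.Re `|c i 0|.
have rE i : (r i)%:C = `|c i 0| by rewrite /r normc_def.
have [i|theta theta_ok thetaE] := @spherical_surj m r.
  by rewrite -lecR rE normr_ge0.
have r1 : \sum_i r i ^+ 2 = 1.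
  apply: complexI; rewrite rmorph_sum /= -[RHS]c1; apply: eq_bigr => i _.
  by rewrite rmorphXn /= rE.
exists phi, theta; split=> // [i|]; first by case: (phiP i).
apply/colP => i; rewrite gen_vectorE; have [_ ->] := phiP i.
by rewrite -rE thetaE r1 sqrtr1 mul1r.
Qed.

(* [u] carries the difference between [a] and the phase of [c 0 0]. *)
Lemma gen_vector_surj_phase m (a : R) (c : 'cV[R[i]]_m.+1) :
  phase_ok a -> \sum_i `|c i 0| ^+ 2 = 1 ->
  exists (phi : 'I_m.+1 -> R) (theta : 'I_m -> R) (u : R[i]),
    [/\ forall i, phase_ok (phi i), forall l, angle_ok (theta l), `|u| = 1,
        phi ord0 = a & c = u *: gen_vector phi theta].
Proof.
move=> a_ok c1; have [phi [theta [phi_ok theta_ok cE]]] := gen_vector_surj c1.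
pose u := cis (phi ord0) / cis a.
have cis0 x : cis x != 0 :> R[i] by rewrite -normr_eq0 normc_cis oner_eq0.
have u1 : `|u| = 1 by rewrite normf_div !normc_cis divr1.
have u0 : u != 0 by rewrite -normr_eq0 u1 oner_eq0.
(* Dividing by [u] shifts every phase; [cis_surj] brings the shifted phases back into the interval
   from 0 to [2 * pi]. *)
have /choice[psi psiP] : forall i, exists x,
    phase_ok x /\ cis x = cis (phi i) / u.
  move=> i; have [|x ? ?] := @cis_surj R (cis (phi i) / u).
    by rewrite normf_div u1 normc_cis divr1.
  by exists x.
exists (fun i => if unlift ord0 i is Some _ then psi i else a), theta, u.
split=> // [i||]; first by case: unliftP => // j _; case: (psiP i).
  by rewrite unlift_none.
rewrite cE; apply/colP => i; rewrite [RHS]mxE !gen_vectorE mulrA; congr (_ * _).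
case: unliftP => [j|] ->; last by rewrite divfK.
by have [_ ->] := psiP (lift ord0 j); rewrite mulrC divfK.
Qed.

End GeneratedMatrix.

(** * Block-diagonal matrices *)

(** The monoid structure makes the lemmas on noncommutative iterated products available for
    [mulmx]. *)
HB.instance Definition _ (T : pzRingType) n :=
  Monoid.isLaw.Build 'M[T]_n 1%:M (@mulmx T n n n) (@mulmxA T n n n n)
    (@mul1mx T n n) (@mulmx1 T n n).

Lemma adj_unitary (C : numClosedFieldType) n (M : 'M[C]_n) :
  M \is unitarymx -> M^t* \is unitarymx.
Proof. by rewrite trmxC_unitary. Qed.

Section BlockDiag.
Variable R : realType.

Section Blocks.
Variables n p r : nat.
Hypothesis pr : (p + r = n)%N.
Implicit Types (X : 'M[R[i]]_p) (M : 'M[R[i]]_r).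

Lemma block_diag_mul X X' M M' :
  block_diag n X M *m block_diag n X' M' = block_diag n (X *m X') (M *m M').
Proof.
(* Once [n] is literally [p + r], [conform_mx] is the identity. *)
subst n; rewrite /block_diag !conform_mx_id mulmx_block.
by rewrite !mulmx0 !mul0mx !addr0 add0r.
Qed.

Lemma block_diag1 : block_diag n (1%:M : 'M[R[i]]_p) (1%:M : 'M[R[i]]_r) = 1%:M.
Proof. by subst n; rewrite /block_diag !conform_mx_id -scalar_mx_block. Qed.

Lemma block_diag_adj X M : (block_diag n X M)^t* = block_diag n (X^t*) (M^t*).
Proof.
subst n; rewrite /block_diag !conform_mx_id tr_block_mx map_block_mx.
by rewrite !trmx0 !map_mx0.
Qed.

Lemma block_diag_unitary X M :
  X \is unitarymx -> M \is unitarymx -> block_diag n X M \is unitarymx.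
Proof.
move=> /unitarymxP X1 /unitarymxP M1; apply/unitarymxP.
by rewrite block_diag_adj block_diag_mul X1 M1 block_diag1.
Qed.

Lemma block_diag_injr X M M' : block_diag n X M = block_diag n X M' -> M = M'.
Proof.
by subst n; rewrite /block_diag !conform_mx_id => /eq_block_mx[].
Qed.

(** Indexing the diagonal by [nat] lets both blocks read the same sequence without casts. *)
Lemma block_diag_diag (d : nat -> R[i]) :
  block_diag n (diag_mx (\row_(i < p) d i))
    (diag_mx (\row_(i < r) d (p + i)%N)) =
  diag_mx (\row_(i < n) d i).
Proof.
subst n; rewrite /block_diag conform_mx_id -diag_mx_row; congr diag_mx.
by apply/rowP => i; rewrite !mxE; case: split_ordP => j ->; rewrite mxE.
Qed.

Lemma corner1 : corner n p (1%:M : 'M[R[i]]_r) = 1%:M.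
Proof. exact: block_diag1. Qed.

Lemma cornerM M M' : corner n p (M *m M') = corner n p M *m corner n p M'.
Proof. by rewrite /corner block_diag_mul mulmx1. Qed.

Lemma corner_unitary M : M \is unitarymx -> corner n p M \is unitarymx.
Proof.
apply: block_diag_unitary; apply/unitarymxP.
by rewrite trmx1 map_mx1 mulmx1.
Qed.

End Blocks.

Lemma block_diag_assoc n p q r s t (X : 'M[R[i]]_p) (Y : 'M[R[i]]_q)
    (Z : 'M[R[i]]_r) :
  (q + r = s)%N -> (p + q = t)%N ->
  block_diag n X (block_diag s Y Z) = block_diag n (block_diag t X Y) Z.
Proof.
move=> es et; subst s t; rewrite /block_diag !conform_mx_id.
have := @block_mxA _ p q r p q r X 0 0 0 Y 0 0 0 Z.
rewrite !row_mx0 !col_mx0 => ->.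
by rewrite conform_castmx.
Qed.

Lemma corner_corner n p q r s (M : 'M[R[i]]_r) : (q + r = s)%N ->
  corner n p (corner s q M) = corner n (p + q) M.
Proof.
by move=> qr; rewrite /corner (block_diag_assoc _ _ _ _ qr erefl) block_diag1.
Qed.

Lemma block_diag_of0 n r (X : 'M[R[i]]_0) (g : 'M[R[i]]_n) : r = n ->
  g \is unitarymx ->
  exists2 M : 'M[R[i]]_r, M \is unitarymx & g = block_diag n X M.
Proof.
move=> e; subst r => gU; exists g => //.
rewrite /block_diag (conform_mx_id _ (block_mx X 0 0 g : 'M[R[i]]_n)).
apply/matrixP => i j; rewrite mxE; case: split_ordP => [[]//|i' ei].
rewrite mxE; case: split_ordP => [[]//|j' ej].
by congr (g _ _); apply: val_inj; [rewrite ei|rewrite ej].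
Qed.

End BlockDiag.

(** * Defect operators *)

Section Defect.
Variable R : realType.

(** The diagonal entries of the product are the squared norms of the columns of [A]. *)
Lemma adj_mul_eq0 m n (A : 'M[R[i]]_(m, n)) : A^t* *m A = 0 -> A = 0.
Proof.
move=> A0; apply/matrixP => i j; have /matrixP/(_ j j) := A0.
rewrite !mxE => /eqP; rewrite psumr_eq0 => [|k _]; last first.
  by rewrite !mxE -normCKC exprn_ge0.
move=> /allP/(_ i (mem_index_enum _)); rewrite !mxE -normCKC sqrf_eq0 normr_eq0.
by move/eqP.
Qed.

Lemma adj_mul_ge0 n (v : 'cV[R[i]]_n) : 0 <= (v^t* *m v) 0 0.
Proof.
by rewrite mxE sumr_ge0 // => k _; rewrite !mxE -normCKC exprn_ge0.
Qed.

Lemma adjM m n p (A : 'M[R[i]]_(m, n)) (B : 'M[R[i]]_(n, p)) :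
  (A *m B)^t* = B^t* *m A^t*.
Proof. by rewrite trmx_mul map_mxM. Qed.

Lemma adjK m n (A : 'M[R[i]]_(m, n)) : A^t*^t* = A.
Proof. by apply/matrixP => i j; rewrite !mxE conjCK. Qed.

Lemma adjB m n (A B : 'M[R[i]]_(m, n)) : (A - B)^t* = A^t* - B^t*.
Proof. by rewrite linearB /= map_mxB. Qed.

Lemma adj1 n : 1%:M^t* = 1%:M :> 'M[R[i]]_n.
Proof. by rewrite trmx1 map_mx1. Qed.

Lemma psd_projection n (P : 'M[R[i]]_n) : orthogonal_projection P -> psd P.
Proof.
move=> [PP Padj]; split=> // v.
by rewrite -PP -{1}Padj !mulmxA -adjM -mulmxA adj_mul_ge0.
Qed.

(* [P] commutes with its square root [D] and [D (1 - P) = 0], so that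
   [E = P - D] satisfies [D E = - E]; as [D >= 0] this forces [E = 0]. *)
Lemma psd_sqrt_projection n (P : 'M[R[i]]_n) :
  orthogonal_projection P -> psd_sqrt P = P.
Proof.
move=> projP; have [PP Padj] := projP; apply: xget_unique.
  by split; [exact: psd_projection|].
move=> D [[Dadj D_ge0] DD].
have DP : D *m P = D.
  suff : D *m (1%:M - P) = 0.
    by rewrite mulmxBr mulmx1 => /subr0_eq.
  (* The product of [D (1 - P)] with its adjoint on the left is [(1 - P) D D (1 - P) = (1 - P) P (1
     - P) = 0]. *)
  apply: adj_mul_eq0; rewrite adjM adjB adj1 Dadj Padj.
  rewrite mulmxA -(mulmxA _ D D) DD.
  by rewrite mulmxBl mul1mx PP subrr mul0mx.
pose E := P - D.
have DE : D *m E = - E by rewrite mulmxBr DP DD opprB.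
suff E0 : E = 0 by apply/esym/subr0_eq.
(* For a column [e] of [E], the nonnegative number [e^* D e] equals minus the squared norm of
   [e]. *)
have colE0 j : col j E = 0.
  apply: adj_mul_eq0; apply/matrixP => a b; rewrite !ord1 [RHS]mxE.
  apply/eqP; rewrite eq_le adj_mul_ge0 andbT.
  have Dcol : D *m col j E = - col j E by rewrite !colE mulmxA DE mulNmx.
  by have := D_ge0 (col j E); rewrite -mulmxA Dcol mulmxN mxE oppr_ge0.
by apply/matrixP => i j; have /colP/(_ i) := colE0 j; rewrite !mxE.
Qed.

Lemma defect_isometry n r (C : 'M[R[i]]_(n, r)) : isometry_mx C ->
  orthogonal_projection (1%:M - defect C) /\
  1%:M - defect C = \sum_j col j C *m (col j C)^t*.
Proof.
move=> C1; have CC : C *m C^t* *m (C *m C^t*) = C *m C^t*.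
  by rewrite mulmxA -(mulmxA C) C1 mulmx1.
have CCadj : (C *m C^t*)^t* = C *m C^t* by rewrite adjM adjK.
rewrite /defect psd_sqrt_projection; last first.
  split; last by rewrite adjB adj1 CCadj.
  by rewrite mulmxBr mulmx1 mulmxBl mul1mx CC subrr subr0.
rewrite subKr; split; first by [].
apply/matrixP => a b; rewrite summxE mxE; apply: eq_bigr => j _.
by rewrite !mxE big_ord1 !mxE.
Qed.

(** [unitarymx] speaks of rows; for a square matrix [mulmx1C] turns this into orthonormality of the
    columns, which any selection of distinct columns inherits. *)
Lemma colsub_isometry n r (A : 'M[R[i]]_n) (f : 'I_r -> 'I_n) :
  injective f -> A \is unitarymx -> isometry_mx (colsub f A).
Proof.
move=> f_inj /unitarymxP/mulmx1C A1; apply/matrixP => a b.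
have /matrixP/(_ (f a) (f b)) := A1; rewrite !mxE (inj_eq f_inj) => <-.
by apply: eq_bigr => i _; rewrite !mxE.
Qed.

Lemma col_colsub m n r (A : 'M[R[i]]_(m, n)) (f : 'I_r -> 'I_n) j :
  col j (colsub f A) = col (f j) A.
Proof. by apply/colP => i; rewrite !mxE. Qed.

Lemma defect_colsub n r (A : 'M[R[i]]_n) (f : 'I_r -> 'I_n) :
  injective f -> A \is unitarymx ->
  [/\ isometry_mx (colsub f A),
      orthogonal_projection (1%:M - defect (colsub f A)) &
      1%:M - defect (colsub f A) = \sum_j col (f j) A *m (col (f j) A)^t*].
Proof.
move=> f_inj A_unitary; have C1 := colsub_isometry f_inj A_unitary.
have [proj E] := defect_isometry C1; split=> //.
by rewrite E; apply: eq_bigr => j _; rewrite col_colsub.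
Qed.

End Defect.

(** * Factorization of unitary matrices *)

Section Factorization.
Variable R : realType.

(** The unitary matrix [K = B^* M] has first column [u] times the first basis vector, which forces
    its first row to vanish off the diagonal. *)
Lemma unitary_same_column m (M B : 'M[R[i]]_m.+1) (u : R[i]) : `|u| = 1 ->
  M \is unitarymx -> B \is unitarymx -> col 0 M = u *: col 0 B ->
  exists2 N : 'M[R[i]]_m, N \is unitarymx &
    M = B *m block_diag m.+1 (u%:M : 'M[R[i]]_1) N.
Proof.
move=> u1 M_unitary B_unitary colM.
have B1 : B^t* *m B = 1%:M by apply/mulmx1C/unitarymxP.
pose K := B^t* *m M.
have /unitarymxP K_unitary := mul_unitarymx (adj_unitary B_unitary) M_unitary.
rewrite -/K in K_unitary.
have MK : M = B *m K by rewrite mulmxA (unitarymxP B_unitary) mul1mx.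
have K_col a : K a 0 = u * (a == 0)%:R.
  have : col 0 K = u *: col 0 (1%:M : 'M[R[i]]_m.+1).
    rewrite -B1 [LHS]colE [col 0 (_ *m _)]colE -!mulmxA -!colE colM.
    by rewrite -scalemxAr.
  by move=> /colP/(_ a); rewrite !mxE.
clearbody K.
(* Columns 0 and [b] of [K] are orthogonal, and column 0 has only the nonzero entry [u]. *)
have K_row b : b != 0 -> K 0 b = 0.
  move=> b0; have /matrixP/(_ 0 b) := mulmx1C K_unitary.
  rewrite !mxE eq_sym (negPf b0) (bigD1 0) //= big1 => [|a a0]; last first.
    by rewrite !mxE K_col (negPf a0) mulr0 conjC0 mul0r.
  rewrite addr0 !mxE K_col eqxx mulr1 => /eqP.
  by rewrite mulf_eq0 conjC_eq0 -normr_eq0 u1 oner_eq0 => /eqP.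
have KE : K = block_mx u%:M 0 0 (@drsubmx _ 1 m 1 m K) :> 'M[R[i]]_(1 + m).
  rewrite -[LHS](@submxK _ 1 m 1 m); congr block_mx.
  - apply/matrixP => a b; rewrite !ord1 !mxE.
    have -> : lshift m 0 = 0 :> 'I_(1 + m) by exact: val_inj.
    by rewrite K_col mulr1.
  - apply/matrixP => a b; rewrite !ord1 !mxE.
    by rewrite -[RHS](K_row (rshift 1 b)); [congr (K _ _); exact: val_inj|].
  - apply/matrixP => a b; rewrite !ord1 !mxE.
    have -> : lshift m 0 = 0 :> 'I_(1 + m) by exact: val_inj.
    by rewrite K_col mulr0.
exists (@drsubmx _ 1 m 1 m K).
  apply/unitarymxP; move: KE; set N := drsubmx _ => KE.
  pose L : 'M[R[i]]_(1 + m) := block_mx u%:M 0 0 N.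
  have : L *m L^t* = 1%:M by rewrite -[L]KE.
  rewrite tr_block_mx map_block_mx mulmx_block scalar_mx_block.
  by move=> /eq_block_mx[_ _ _]; rewrite mul0mx add0r.
pose L : 'M[R[i]]_(1 + m) := block_mx u%:M 0 0 (@drsubmx _ 1 m 1 m K).
by rewrite /block_diag (conform_mx_id _ L) /L -KE.
Qed.

(** The parameter families range over all natural numbers [p], so that an induction on the number
    [q] of factors can extend them without changing their type. *)
Definition stiefel n (phi : forall p, 'I_(n - p.+1).+1 -> R)
    (theta : forall p, 'I_(n - p.+1) -> R) q : 'M[R[i]]_n :=
  \big[mulmx/1%:M]_(p < q) corner n p (gen_matrix (phi p) (theta p)).

Definition params_ok m (phi : 'I_m.+1 -> R) (theta : 'I_m -> R) :=
  (forall i, phase_ok (phi i)) /\ forall l, angle_ok (theta l).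

(* [S p] constrains the first phase of the [p]-th generating vector, and [W]
   the phases left over on the diagonal. *)
Lemma stiefel_factorization (S : nat -> R -> Prop) (W : R[i] -> Prop) n q
    (g : 'M[R[i]]_n) :
  (forall p m (c : 'cV[R[i]]_m.+1), \sum_i `|c i 0| ^+ 2 = 1 ->
     exists (phi : 'I_m.+1 -> R) theta u,
       [/\ params_ok phi theta, S p (phi ord0), `|u| = 1, W u &
           c = u *: gen_vector phi theta]) ->
  (q <= n)%N -> g \is unitarymx ->
  exists (phi : forall p, 'I_(n - p.+1).+1 -> R)
         (theta : forall p, 'I_(n - p.+1) -> R)
         (d : nat -> R[i]) (M : 'M[R[i]]_(n - q)),
    [/\ forall p, (p < q)%N ->
          params_ok (phi p) (theta p) /\ S p (phi p ord0),
        forall p, (p < q)%N -> `|d p| = 1 /\ W (d p),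
        M \is unitarymx &
        g = stiefel phi theta q *m block_diag n (diag_mx (\row_(i < q) d i)) M].
Proof.
move=> step qn g_unitary; elim: q qn => [|q IHq] qn.
  have [M M_unitary gE] :=
    block_diag_of0 (diag_mx (\row_(i < 0) (0 : R[i]))) (subn0 n) g_unitary.
  exists (fun _ _ => 0), (fun _ _ => 0), (fun=> 0), M; split=> //.
  by rewrite /stiefel big_ord0 mul1mx.
have [phi [theta [d [M [phi_ok d_ok M_unitary gE]]]]] := IHq (ltnW qn).
(* The remaining block has positive size, hence a first column from which the next factor is
   generated. *)
have e : (n - q)%N = (n - q.+1).+1 by rewrite -subSn.
move: M M_unitary gE; rewrite e => M M_unitary gE.
have [|phiq [thetaq [u [paramq_ok Sq u1 Wu colM]]]] := step q _ (col 0 M).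
  have /unitarymxP/mulmx1C/matrixP/(_ 0 0) := M_unitary.
  rewrite !mxE eqxx mulr1n => <-; apply: eq_bigr => i _.
  by rewrite !mxE normCKC.
have col_gen : col 0 (gen_matrix phiq thetaq) = gen_vector phiq thetaq.
  by apply/colP => i; rewrite mxE row_mx_ord0.
have [|N N_unitary MN] := unitary_same_column u1 M_unitary
  (gen_matrix_unitary phiq thetaq) _; first by rewrite col_gen.
pose d' p := if p == q then u else d p.
(* Only the entries at [q] are replaced; the factors before [q] and their phases stay as they
   were. *)
exists (eqtype.dfwith phi phiq), (eqtype.dfwith theta thetaq), d', N.
split=> // [p|p|].
- rewrite ltnS leq_eqVlt; case: eqVneq => [-> _|pq /= /phi_ok].
    by rewrite !dfwith_in.
  by rewrite !dfwith_out // eq_sym.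
- by rewrite ltnS leq_eqVlt /d'; case: eqVneq => [//|pq /= /d_ok].
have q1 : (q + 1 = q.+1)%N by rewrite addn1.
have qN : (q + (n - q.+1).+1 = n)%N by rewrite -e subnKC // ltnW.
rewrite gE [in RHS]/stiefel big_ord_recr.
rewrite [X in X *m _ *m _](_ : _ = stiefel phi theta q); last first.
  apply: eq_bigr => p _; have qp : q != p by rewrite gtn_eqF.
  by rewrite !dfwith_out.
rewrite -[RHS]mulmxA; congr (stiefel _ _ _ *m _); rewrite /= !dfwith_in.
have dE : diag_mx (\row_(i < q) d i) = diag_mx (\row_(i < q) d' i).
  by congr diag_mx; apply/rowP => i; rewrite !mxE /d' (ltn_eqF (ltn_ord i)).
have uE : u%:M = diag_mx (\row_(i < 1) d' (q + i)%N) :> 'M[R[i]]_1.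
  by apply/matrixP => a b; rewrite !ord1 !mxE /d' addn0 !eqxx.
(* The scalar [u] moves from the top of the lower block to the end of the diagonal. *)
rewrite MN -(block_diag_diag q1 d') -(block_diag_assoc _ _ _ _ (add1n _) q1).
by rewrite /corner (block_diag_mul qN) mul1mx dE uE.
Qed.
End Factorization.

(** * Dependence on the parameters *)

Section MatrixProducts.
Variable R : realType.

(** The factors on either side of [p] agree and are invertible, so they cancel: the earlier ones on
    the left by induction, the later ones on the right all at once. *)
Lemma big_mulmx_cancel (I : eqType) (s : seq I) n (F G : I -> 'M[R[i]]_n) p :
  p \in s -> uniq s ->
  (forall q, q != p -> F q = G q /\ F q \is unitarymx) ->
  \big[mulmx/1%:M]_(q <- s) F q = \big[mulmx/1%:M]_(q <- s) G q -> F p = G p.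
Proof.
move=> + + FG; elim: s => // x s IHs; rewrite inE /= !big_cons.
have [<-{x} _ /andP[ps _]|px /= p_s /andP[_ s_uniq]] := eqVneq p x.
  have FGs q : q \in s -> F q = G q /\ F q \is unitarymx.
    by move=> qs; apply: FG; apply: contraNneq ps => <-.
  rewrite (eq_big_seq G) => [|q /FGs[] //].
  apply: (can_inj (mulmxK _)); apply: unitarymx_unit.
  rewrite big_seq; apply: (big_ind (fun M => M \is unitarymx)).
  - by apply/unitarymxP; rewrite adj1 mulmx1.
  - exact: mul_unitarymx.
  - by move=> q /FGs[<-].
have [FGx /unitarymx_unit Fx_unit] : F x = G x /\ F x \is unitarymx.
  by apply: FG; rewrite eq_sym.
by rewrite -FGx => /(can_inj (mulKmx Fx_unit)); apply: IHs.
Qed.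

Lemma big_mulmx_split n N k (F : 'I_N -> 'M[R[i]]_n) :
  \big[mulmx/1%:M]_(p < N) F p =
  (\big[mulmx/1%:M]_(p < N | (p < k)%N) F p) *m
  (\big[mulmx/1%:M]_(p < N | (k <= p)%N) F p).
Proof.
elim: N F => [|N IHN] F; first by rewrite !big_ord0 mulmx1.
rewrite big_ord_recr /= IHN [in RHS]big_mkcond big_ord_recr -big_mkcond /=.
(* The last factor joins the second product if [k <= N]; otherwise that product is empty. No factors
   are reordered. *)
rewrite [X in _ = _ *m X]big_mkcond big_ord_recr -big_mkcond /=.
case: (leqP k N) => kN; first by rewrite mulmx1 mulmxA.
rewrite [X in _ *m X *m _]big_pred0 => [|p]; last first.
  by apply/negbTE; rewrite -ltnNge (ltn_trans (ltn_ord p)).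
rewrite [X in _ = _ *m (X *m _)]big_pred0 => [|p]; last first.
  by apply/negbTE; rewrite -ltnNge (ltn_trans (ltn_ord p)).
by rewrite !mulmx1.
Qed.

Lemma big_corner_unitary (I : Type) (s : seq I) (P : pred I) n (p r : I -> nat)
    (M : forall x, 'M[R[i]]_(r x)) :
  (forall x, P x -> (p x + r x = n)%N /\ M x \is unitarymx) ->
  \big[mulmx/1%:M]_(x <- s | P x) corner n (p x) (M x) \is unitarymx.
Proof.
move=> PM; apply: (big_ind (fun M => M \is unitarymx)).
- by apply/unitarymxP; rewrite adj1 mulmx1.
- exact: mul_unitarymx.
- by move=> x /PM[pr M_unitary]; apply: corner_unitary.
Qed.

Lemma corner_inj n p r (M N : 'M[R[i]]_r) :
  (p + r = n)%N -> corner n p M = corner n p N -> M = N.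
Proof. by move=> pr; apply: block_diag_injr. Qed.

End MatrixProducts.

Section Dependence.
Variable R : realType.
Local Open Scope complex_scope.

(** These angles place the generating vector on the [j]-th coordinate axis, where a change of angle
    [j] or phase [j] is visible. *)
Definition step_angle j l : R := if (l < j)%N then pi / 2 else 0.

Lemma spherical_step m (i : 'I_m.+1) :
  spherical (fun l : 'I_m => step_angle i l) i = 1.
Proof.
rewrite /spherical !big1 ?mulr1 // => l.
  by move=> /eqP li; rewrite /step_angle li ltnn cos0.
by move=> li; rewrite /step_angle li sin_pihalf.
Qed.

Lemma spherical_pihalf m (theta : 'I_m -> R) (l : 'I_m) (i : 'I_m.+1) :
  l = i :> nat -> theta l = pi / 2 -> spherical theta i = 0.
Proof.
move=> li theta_l; rewrite /spherical [X in _ * X](bigD1 l) /= ?li //.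
by rewrite theta_l cos_pihalf mul0r mulr0.
Qed.

Lemma gen_matrix_col0 m (phi : 'I_m.+1 -> R) theta i :
  gen_matrix phi theta i ord0 = cis (phi i) * (spherical theta i)%:C.
Proof. by rewrite row_mx_ord0 gen_vectorE. Qed.

(** Entry [l] of the first column has modulus 1 on the left, and on the right it contains the factor
    [cos (pi / 2)]. *)
Lemma gen_matrix_angle_neq m (phi phi' : 'I_m.+1 -> R) theta theta' (l : 'I_m) :
  theta =1 (fun x => step_angle l x) -> theta' l = pi / 2 ->
  gen_matrix phi theta <> gen_matrix phi' theta'.
Proof.
move=> /funext -> theta'l; pose i : 'I_m.+1 := widen_ord (leqnSn m) l.
have step1 : spherical (fun x : 'I_m => step_angle l x) i = 1.
  exact: spherical_step i.
move=> /matrixP/(_ i ord0); rewrite !gen_matrix_col0.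
rewrite (spherical_pihalf (theta := theta') (l := l)) // step1 mulr0 mulr1.
by move/eqP; rewrite -normr_eq0 normc_cis oner_eq0.
Qed.

Lemma gen_matrix_phase_neq m (phi phi' : 'I_m.+1 -> R) theta (i : 'I_m.+1) :
  theta =1 (fun x => step_angle i x) -> phi i = 0 -> phi' i = pi ->
  gen_matrix phi theta <> gen_matrix phi' theta.
Proof.
move=> /funext -> phii phi'i /matrixP/(_ i ord0); rewrite !gen_matrix_col0.
rewrite phii phi'i spherical_step !mulr1 /cis cos0 cospi => -[/eqP].
by rewrite eq_sym lt_eqF // (@lt_trans _ _ 0) ?ltrN10 ?ltr01.
Qed.

Lemma pihalf_ok : angle_ok (pi / 2 : R).
Proof. by rewrite /angle_ok lexx divr_ge0 // pi_ge0. Qed.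

Lemma angle0_ok : angle_ok (0 : R).
Proof. by rewrite /angle_ok lexx divr_ge0 // pi_ge0. Qed.

Lemma phase0_ok : phase_ok (0 : R).
Proof. by rewrite /phase_ok lexx mulr_gt0 // pi_gt0. Qed.

Lemma phase_pi_ok : phase_ok (pi : R).
Proof. by rewrite /phase_ok pi_ge0 mulr_natl mulr2n ltrDl pi_gt0. Qed.

Section Index.
Variables (k : nat) (a b : 'I_k -> nat).
Let index := {p : 'I_k & ('I_(a p) + 'I_(b p))%type}.

(** Factor [p] has [a p] angles and [b p] phases; taking [b p] equal to [a p] or to [(a p).+1]
    covers the fixed and the free first phase together. *)
Definition param_ok (x : index) (v : R) : Prop :=
  if tagged x is inl _ then angle_ok v else phase_ok v.

Definition step_params j (x : index) : R :=
  if tagged x is inl l then step_angle j l else 0.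

Lemma step_params_ok j x : param_ok x (step_params j x).
Proof.
case: x => p [l|l]; rewrite /param_ok /step_params /=; last exact: phase0_ok.
by rewrite /step_angle; case: ifP => _; [exact: pihalf_ok|exact: angle0_ok].
Qed.

Lemma with_ok (t : index -> R) i v : (forall x, param_ok x (t x)) ->
  param_ok i v -> forall x, param_ok x ([eta t with i |-> v] x).
Proof. by move=> t_ok v_ok x /=; case: eqP => // ->. Qed.

Lemma with_tag_neq (t : index -> R) i v x :
  tag x != tag i -> [eta t with i |-> v] x = t x.
Proof. by move=> xi /=; case: eqP => // e; rewrite e eqxx in xi. Qed.

Lemma with_phase_angle (t : index -> R) p (j : 'I_(b p)) (l : 'I_(a p)) v :
  let T p := ('I_(a p) + 'I_(b p))%type in
  [eta t with existT T p (inr j) |-> v] (existT T p (inl l)) =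
  t (existT T p (inl l)).
Proof. by rewrite /= -/(Tagged _ _) eq_Tagged. Qed.

Lemma card_index : #|{: index}| = (\sum_(p < k) (a p + b p))%N.
Proof.
rewrite card_tagged sumnE big_map big_enum /=.
by apply: eq_bigr => p _; rewrite card_sum !card_ord.
Qed.

(** A parameter enters only one factor, so by cancellation it suffices that this factor changes with
    it. *)
Lemma depends_index n (D : set (index -> R)) (A : (index -> R) -> 'M[R[i]]_n)
    (r : 'I_k -> nat) (F : (index -> R) -> forall p, 'M[R[i]]_(r p)) :
  (forall t, (forall x, param_ok x (t x)) -> D t) ->
  (forall p : 'I_k, (p + r p = n)%N) ->
  (forall t p, F t p \is unitarymx) ->
  (forall t, A t = \big[mulmx/1%:M]_(p < k) corner n p (F t p)) ->
  (forall t t' p, (forall x, tag x = p -> t x = t' x) -> F t p = F t' p) ->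
  (forall p s, let i : index := existT _ p s in exists j v, param_ok i v /\
     F (step_params j) p <> F [eta step_params j with i |-> v] p) ->
  depends_on_parameters D A (\sum_(p < k) (a p + b p))%N.
Proof.
move=> D_ok size_n F_unitary AE F_local F_neq; split; first exact: card_index.
case=> p s; have [j [v [v_ok F_ne]]] := F_neq p s; set i := existT _ p s.
exists (step_params j), [eta step_params j with i |-> v]; split.
- by apply: D_ok => x; apply: step_params_ok.
- by apply: D_ok; apply: with_ok => // x; apply: step_params_ok.
- by move=> x xi /=; rewrite (negPf xi).
rewrite !AE => /(big_mulmx_cancel (mem_index_enum p)) E; apply: F_ne.
apply: (corner_inj (size_n p)); apply: E; first exact: index_enum_uniq.
move=> q qp; split; last exact: corner_unitary.
congr (corner n q _); apply: F_local => x xq.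
by rewrite with_tag_neq // xq.
Qed.

End Index.
End Dependence.

(** * The Stiefel manifolds *)

Section Stiefel.
Variables (R : realType) (n k : nat).
Hypothesis hkn : (k <= n.-1)%N.

Lemma lt_size (p : 'I_k) : (p < n)%N.
Proof. exact: leq_trans (ltn_ord p) (leq_trans hkn (leq_pred n)). Qed.

Lemma factor_size (p : 'I_k) : (p + (n - p.+1).+1 = n)%N.
Proof. by rewrite -subSn ?lt_size // subSS subnKC // ltnW // lt_size. Qed.

Lemma le_size : (k <= n)%N.
Proof. exact: leq_trans hkn (leq_pred n). Qed.

Lemma fixed_stiefel_unitary (t : fixed_index n k -> R) :
  fixed_stiefel t \is unitarymx.
Proof.
apply: big_corner_unitary => p _; split; first exact: factor_size.
exact: gen_matrix_unitary.
Qed.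

Lemma free_stiefel_unitary (t : free_index n k -> R) :
  free_stiefel t \is unitarymx.
Proof.
apply: big_corner_unitary => p _; split; first exact: factor_size.
exact: gen_matrix_unitary.
Qed.

(** With free phases each leftover scalar can be required to be 1, so the right-hand remainder lies
    in [corner_U n k]. *)
Lemma free_coset (X : set 'M[R[i]]_n) : coset_space (corner_U n k) X ->
  exists2 t : free_index n k -> R, free_admissible t & X (free_stiefel t).
Proof.
move=> [g g_unitary <-].
have [p m c c1||phi [theta [d [M [params d1 M_unitary gE]]]]] :=
  @stiefel_factorization R (fun _ _ => True) (fun u => u = 1) n k g _ _
    g_unitary.
- have [phi [theta [phi_ok theta_ok cE]]] := gen_vector_surj c1.
  by exists phi, theta, 1; rewrite scale1r normr1.
- exact: le_size.
pose t (x : free_index n k) : R := match tagged x with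
  | inl l => theta (tag x) l | inr l => phi (tag x) l end.
exists t; first by move=> p; have [[]] := params p (ltn_ord p).
have tE : free_stiefel t = stiefel phi theta k by [].
(* Since [g] is the Stiefel matrix times [corner n k M], the inverse of this corner leads from [g]
   back to it. *)
exists (corner n k (M^t*)); first by exists (M^t*); first exact: adj_unitary.
have -> : corner n k (M^t*) = (corner n k M)^t*.
  by rewrite (block_diag_adj (subnKC le_size)) adj1.
rewrite gE tE.
have -> : diag_mx (\row_(i < k) d i) = 1%:M.
  rewrite -diag_const_mx; congr diag_mx; apply/rowP => i; rewrite !mxE.
  by have [] := d1 i (ltn_ord i).
rewrite -mulmxA (unitarymxP (corner_unitary (subnKC le_size) M_unitary)).
exact: mulmx1.
Qed.

(** Here the first phases are prescribed and the leftover scalars are arbitrary of modulus 1; they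
    form the diagonal unitary block of the subgroup. *)
Lemma fixed_coset (X : set 'M[R[i]]_n) : coset_space (torus_corner_U n k) X ->
  exists2 t : fixed_index n k -> R, fixed_admissible t & X (fixed_stiefel t).
Proof.
move=> [g g_unitary <-].
have [p m c c1||phi [theta [d [M [params d1 M_unitary gE]]]]] :=
  @stiefel_factorization R (fun p x => x = if p == 0%N then 0 else pi)
    (fun=> True) n k g _ _ g_unitary.
- have [|phi [theta [u [phi_ok theta_ok u1 phi0 cE]]]] :=
    gen_vector_surj_phase (a := if p == 0%N then 0 else pi) _ c1.
    by case: ifP => _; [exact: phase0_ok|exact: phase_pi_ok].
  by exists phi, theta, u.
- exact: le_size.
pose t (x : fixed_index n k) : R := match tagged x with
  | inl l => theta (tag x) l | inr l => phi (tag x) (lift ord0 l) end.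
exists t.
  by move=> p; have [[phi_ok theta_ok] _] := params p (ltn_ord p);
    split=> l; [exact: theta_ok|exact: phi_ok].
have tE : fixed_stiefel t = stiefel phi theta k.
  rewrite /fixed_stiefel /stiefel; apply: eq_bigr => p _.
  rewrite /fixed_factor (_ : fixed_phase t (p := p) = phi p) //.
  apply/funext => j; rewrite /fixed_phase; case: unliftP => [l|] -> //.
  by have [_ ->] := params p (ltn_ord p).
pose D := diag_mx (\row_(i < k) d i).
have D_unitary : D \is unitarymx.
  apply/unitarymxP/matrixP => i j; rewrite mul_diag_mx !mxE.
  have [<-|] := eqVneq j i; last by rewrite !mulr0n conjC0 mulr0.
  by rewrite mulr1n -normCK; have [-> _] := d1 j (ltn_ord j); rewrite expr1n.
exists (block_diag n (D^t*) (M^t*)).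
  exists (D^t*), (M^t*); split; [|exact: adj_unitary|exact: adj_unitary|by []].
  by rewrite tr_diag_mx map_diag_mx; apply: diag_mx_is_diag.
rewrite -(block_diag_adj (subnKC le_size)) gE tE -mulmxA.
rewrite (unitarymxP (block_diag_unitary (subnKC le_size) D_unitary M_unitary)).
exact: mulmx1.
Qed.

Lemma fixed_flag (s : fixed_index n n.-1 -> R) :
  [/\ flag_tail k s \is unitarymx,
      flag_matrix s = flag_with s (flag_tail k s) &
      fixed_stiefel (flag_restrict hkn s) =
        flag_with s (1%:M : 'M[R[i]]_(n - k))].
Proof.
have flag_size (p : 'I_n.-1) : (k <= p)%N ->
    (p - k + (n - p.+1).+1 = n - k)%N.
  by case: p => p /=; lia.
have kn := subnKC le_size.
split.
- apply: big_corner_unitary => p kp; split; first exact: flag_size.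
  exact: gen_matrix_unitary.
- rewrite /flag_matrix /flag_with (big_mulmx_split k); congr (_ *m _).
  (* [corner n k] is multiplicative, and a corner at offset [p - k] inside one at offset [k] is a
     corner at offset [p]. *)
  rewrite (big_morph _ (cornerM kn) (corner1 R kn)).
  apply: eq_bigr => p kp.
  by rewrite (corner_corner _ _ _ (flag_size p kp)) subnKC.
- by rewrite /flag_with (corner1 R kn) mulmx1 (big_ord_narrow hkn).
Qed.

Lemma fixed_dependence :
  depends_on_parameters (@fixed_admissible R n k) (@fixed_stiefel R n k)
    (\sum_(p < k) ((n - p.+1) + (n - p.+1)))%N.
Proof.
pose a (p : 'I_k) := (n - p.+1)%N.
apply: (@depends_index R k a a n _ _ (fun p => (n - p.+1).+1)
  (fun t p => gen_matrix (fixed_phase t (p := p)) (fixed_angle t (p := p))))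
  => [t t_ok|p|t p|//|t t' p tt'|p [l|l] i].
- move=> p; split=> l.
    by have := t_ok (existT _ p (inl l));
      rewrite /param_ok /angle_ok /fixed_angle /=.
  by have := t_ok (existT _ p (inr l));
      rewrite /param_ok /phase_ok /other_phase /=.
- exact: factor_size.
- exact: gen_matrix_unitary.
- have angleE : fixed_angle t (p := p) = fixed_angle t' (p := p).
    by apply/funext => l; apply: tt'.
  have phaseE : fixed_phase t (p := p) = fixed_phase t' (p := p).
    apply/funext => l; rewrite /fixed_phase; case: unlift => // l'; exact: tt'.
  by rewrite angleE phaseE.
- exists l, (pi / 2); split; first exact: pihalf_ok.
  apply: (gen_matrix_angle_neq (l := l)) => //.
  by rewrite /fixed_angle /= eqxx.
(* The first phase is not a parameter, so the parameter phase [l] belongs to row [l.+1]; the angles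
   must select that row. *)
- exists l.+1, pi; split; first exact: phase_pi_ok.
  have -> : fixed_angle [eta step_params R l.+1 with i |-> pi] (p := p) =
      fixed_angle (step_params R l.+1) (p := p).
    apply/funext => l'; exact: (with_phase_angle (a := a) (b := a)).
  pose j : 'I_(n - p.+1).+1 := lift ord0 l.
  apply: (@gen_matrix_phase_neq _ _ _ _ _ j) => //.
    by rewrite /fixed_phase liftK.
  by rewrite /fixed_phase liftK /other_phase /= eqxx.
Qed.

Lemma free_dependence :
  depends_on_parameters (@free_admissible R n k) (@free_stiefel R n k)
    (\sum_(p < k) ((n - p.+1) + (n - p.+1).+1))%N.
Proof.
pose a (p : 'I_k) := (n - p.+1)%N.
apply: (@depends_index R k a (fun p => (a p).+1) n _ _ (fun p => (n - p.+1).+1)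
  (fun t p => gen_matrix (free_phase t (p := p)) (free_angle t (p := p))))
  => [t t_ok|p|t p|//|t t' p tt'|p [l|l] i].
- move=> p; split=> l.
    by have := t_ok (existT _ p (inl l));
      rewrite /param_ok /angle_ok /free_angle /=.
  by have := t_ok (existT _ p (inr l));
      rewrite /param_ok /phase_ok /free_phase /=.
- exact: factor_size.
- exact: gen_matrix_unitary.
- have angleE : free_angle t (p := p) = free_angle t' (p := p).
    by apply/funext => l; apply: tt'.
  have phaseE : free_phase t (p := p) = free_phase t' (p := p).
    by apply/funext => l; apply: tt'.
  by rewrite angleE phaseE.
- exists l, (pi / 2); split; first exact: pihalf_ok.
  apply: (gen_matrix_angle_neq (l := l)) => //.
  by rewrite /free_angle /= eqxx.
- exists l, pi; split; first exact: phase_pi_ok.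
  have -> : free_angle [eta step_params R l with i |-> pi] (p := p) =
      free_angle (step_params R l) (p := p).
    apply/funext => l'.
    exact: (with_phase_angle (a := a) (b := fun p => (a p).+1)).
  apply: (gen_matrix_phase_neq (i := l)) => //.
  by rewrite /free_phase /= eqxx.
Qed.

End Stiefel.

(** * Counting the parameters and assembling the statement *)

Lemma fixed_count n k : (k <= n.-1)%N ->
  (\sum_(p < k) ((n - p.+1) + (n - p.+1)) = k * (2 * n - k - 1))%N.
Proof.
elim: k => [|k IHk] kn; first by rewrite big_ord0.
rewrite big_ord_recr /= IHk; nia.
Qed.

Lemma free_count n k : (k <= n)%N ->
  (\sum_(p < k) ((n - p.+1) + (n - p.+1).+1) = k * (2 * n - k))%N.
Proof.
elim: k => [|k IHk] kn; first by rewrite big_ord0.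
rewrite big_ord_recr /= IHk; nia.
Qed.

Lemma fixed_dimension n k : (k <= n.-1)%N ->
  (n ^ 2 - k - (n - k) ^ 2 = k * (2 * n - k - 1))%N.
Proof. rewrite -!mulnn; nia. Qed.

Lemma free_dimension n k : (k <= n)%N ->
  (n ^ 2 - (n - k) ^ 2 = k * (2 * n - k))%N.
Proof. rewrite -!mulnn; nia. Qed.

Theorem theorem2 (R : realType) (n k : nat) (hk : (1 <= k)%N)
    (hkn : (k <= n.-1)%N) :
  [/\ (* (i) the representation of U(n)/(U(1)^k x U(n-k)) *)
      (forall t : fixed_index n k -> R,
         fixed_admissible t -> U (fixed_stiefel t)) /\
      (forall X : set 'M[R[i]]_n, coset_space (torus_corner_U n k) X ->
         exists2 t : fixed_index n k -> R,
           fixed_admissible t & X (fixed_stiefel t)),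
      (* (i) how it is obtained from the flag matrix *)
      (forall s : fixed_index n n.-1 -> R, fixed_admissible s ->
         [/\ U (flag_tail k s),
             flag_matrix s = flag_with s (flag_tail k s),
             fixed_admissible (flag_restrict hkn s) &
             fixed_stiefel (flag_restrict hkn s) =
               flag_with s (1%:M : 'M[R[i]]_(n - k))]),
      (* (i) the number of parameters *)
      depends_on_parameters (@fixed_admissible R n k) (@fixed_stiefel R n k)
        (n ^ 2 - k - (n - k) ^ 2)%N /\
      (n ^ 2 - k - (n - k) ^ 2 = k * (2 * n - k - 1))%N,
      (* (i) the projection, for the first k columns and for any k columns *)
      (forall t : fixed_index n k -> R, fixed_admissible t ->
         let A := fixed_stiefel t in
         let first := widen_ord (leq_trans hkn (leq_pred n)) in
         [/\ isometry_mx (colsub first A),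
             orthogonal_projection (1%:M - defect (colsub first A)),
             1%:M - defect (colsub first A) =
               \sum_(j < k) col (first j) A *m (col (first j) A)^t* &
             forall S : {set 'I_n}, #|S| = k ->
               let C := colsub (fun j : 'I_#|S| => enum_val j) A in
               [/\ isometry_mx C, orthogonal_projection (1%:M - defect C) &
                   1%:M - defect C =
                     \sum_(j in S) col j A *m (col j A)^t*]]) /\
      #|[set S : {set 'I_n} | #|S| == k]%SET| = 'C(n, k) &
      (* (ii) the representation of U(n)/U(n-k) and the number of parameters *)
      [/\ forall t : free_index n k -> R,
            free_admissible t -> U (free_stiefel t),
          forall X : set 'M[R[i]]_n, coset_space (corner_U n k) X ->
            exists2 t : free_index n k -> R,
              free_admissible t & X (free_stiefel t),
          depends_on_parameters (@free_admissible R n k) (@free_stiefel R n k)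
            (n ^ 2 - (n - k) ^ 2)%N &
          (n ^ 2 - (n - k) ^ 2 = k * (2 * n - k))%N]].
Proof.
have kn := le_size hkn.
split.
- split; [by move=> t _; exact: fixed_stiefel_unitary|exact: fixed_coset].
- move=> s s_ok; have [tailU flagE restrictE] := fixed_flag hkn s.
  by split=> // p; exact: (s_ok (widen_ord hkn p)).
- split; last exact: fixed_dimension.
  by rewrite fixed_dimension // -fixed_count //; exact: fixed_dependence.
- split; last by rewrite -[in RHS](card_ord n) -card_draws.
  move=> t _ A first; have A_unitary := fixed_stiefel_unitary hkn t.
  have first_inj : injective first by move=> x y [] /val_inj.
  have [C1 proj projE] := defect_colsub first_inj A_unitary.
  (* [enum_val] lists the elements of [S] injectively, so an arbitrary choice of columns is handled
     like the first ones. *)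
  split=> // S _ C; have [D1 projD projDE] :=
    defect_colsub (enum_val_inj (A := S)) A_unitary.
  by split=> //; rewrite projDE [RHS]big_enum_val.
- split; last exact: free_dimension.
  + by move=> t _; exact: free_stiefel_unitary.
  + exact: free_coset.
  + by rewrite free_dimension // -free_count //; exact: free_dependence.
Qed.
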